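(* Let $M,N>0$ be real numbers. For every $n\in\mathbb{N}_0$, the Krall polynomial $y_n(x)=P_n^{0,0,M,N}(x)$ satisfies the sixth-order differential equation $$D_x\big[(x^2-1)D_xy_n(x)\big]+\frac{M}{2}(x+1)D_x^2\Big\{(x-1)^2D_x^2\big[(x+1)y_n(x)\big]\Big\}+\frac{N}{2}(x-1)D_x^2\Big\{(x+1)^2D_x^2\big[(x-1)y_n(x)\big]\Big\}$$ $$+\frac{MN}{3}(x^2-1)D_x^3\Big\{(x^2-1)D_x^3\big[(x^2-1)y_n(x)\big]\Big\}=(n)_2\Big\{1+\frac{M+N}{2}(n)_2+\frac{MN}{3}(n-1)_4\Big\}y_n(x).$$
   Context: $\mathbb{N}_0=\{0,1,2,\dots\}$; $(a)_k=a(a+1)\cdots(a+k-1)$, $(a)_0=1$, is the Pochhammer symbol; $D_x^i$ denotes $i$-fold differentiation with respect to $x$, acting on everything inside the bracket that follows. Jacobi polynomials: $P_n^{\alpha,\beta}(x)=\frac{(\alpha+1)_n}{n!}\,{}_2F_1\big(-n,n+\alpha+\beta+1;\alpha+1;\frac{1-x}{2}\big)$, $n\in\mathbb{N}_0$. Koornwinder's generalized Jacobi polynomials: $P_n^{\alpha,\beta,M,N}(x)=P_n^{\alpha,\beta}(x)+MQ_n^{\alpha,\beta}(x)+NR_n^{\alpha,\beta}(x)+MNS_n^{\alpha,\beta}(x)$, $n\in\mathbb{N}_0$, where $Q_0^{\alpha,\beta}=R_0^{\alpha,\beta}=S_0^{\alpha,\beta}=S_1^{\alpha,\beta}=0$ and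 $Q_n^{\alpha,\beta}(x)=q_n^{\alpha,\beta}(x+1)P_{n-1}^{\alpha,\beta+2}(x)$ with $q_n^{\alpha,\beta}=\frac{(\alpha+\beta+2)_n(\beta+2)_{n-1}}{2\,n!\,(\alpha+1)_{n-1}}$ for $n\ge1$; $R_n^{\alpha,\beta}(x)=r_n^{\alpha,\beta}(x-1)P_{n-1}^{\alpha+2,\beta}(x)$ with $r_n^{\alpha,\beta}=\frac{(\alpha+\beta+2)_n(\alpha+2)_{n-1}}{2\,n!\,(\beta+1)_{n-1}}$ for $n\ge1$; $S_n^{\alpha,\beta}(x)=s_n^{\alpha,\beta}(x^2-1)P_{n-2}^{\alpha+2,\beta+2}(x)$ with $s_n^{\alpha,\beta}=\frac{(\alpha+\beta+2)_n(\alpha+\beta+2)_{n+1}}{4(\alpha+1)(\beta+1)(n-1)!\,n!}$ for $n\ge2$. The Krall polynomials are the case $\alpha=\beta=0$. *)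

(* Defs.v *)
From mathcomp Require Import all_boot all_order all_algebra reals.

Set Implicit Arguments.
Unset Strict Implicit.
Unset Printing Implicit Defensive.

Import GRing.Theory Num.Theory.

Local Open Scope ring_scope.

Definition poch (R : realType) (a : R) (k : nat) : R :=
  \prod_(i < k) (a + i%:R).

(* The terminating series 2F1(-n, b; c; z), with z a polynomial: its terms of
   index k > n vanish because (-n)_k = 0. *)
Definition hyp2F1_term (R : realType) (n : nat) (b c : R) (z : {poly R}) :
    {poly R} :=
  \sum_(k < n.+1)
    (poch (- n%:R) k * poch b k / (poch c k * k`!%:R)) *: z ^+ k.

Definition jacobi (R : realType) (a b : R) (n : nat) : {poly R} :=
  (poch (a + 1) n / n`!%:R) *:
    hyp2F1_term n (n%:R + a + b + 1) (a + 1) (2^-1 *: (1 - 'X)).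

Definition koornwinderQ (R : realType) (a b : R) (n : nat) : {poly R} :=
  if n is m.+1 then
    (poch (a + b + 2) n * poch (b + 2) m / (2 * n`!%:R * poch (a + 1) m)) *:
      (('X + 1) * jacobi a (b + 2) m)
  else 0.

Definition koornwinderR (R : realType) (a b : R) (n : nat) : {poly R} :=
  if n is m.+1 then
    (poch (a + b + 2) n * poch (a + 2) m / (2 * n`!%:R * poch (b + 1) m)) *:
      (('X - 1) * jacobi (a + 2) b m)
  else 0.

Definition koornwinderS (R : realType) (a b : R) (n : nat) : {poly R} :=
  if n is m.+2 then
    (poch (a + b + 2) n * poch (a + b + 2) n.+1 /
      (4 * (a + 1) * (b + 1) * (n.-1)`!%:R * n`!%:R)) *:
      (('X^2 - 1) * jacobi (a + 2) (b + 2) m)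
  else 0.

Definition koornwinder (R : realType) (a b M N : R) (n : nat) : {poly R} :=
  jacobi a b n + M *: koornwinderQ a b n + N *: koornwinderR a b n
    + (M * N) *: koornwinderS a b n.

Definition krall (R : realType) (M N : R) (n : nat) : {poly R} :=
  koornwinder 0 0 M N n.

(* Main.v *)
(* Write [P] for the Legendre polynomial [P_n] and [L = n (n + 1)].  Comparing
   coefficients in powers of [(1 - x) / 2] gives
   [Q_n = (x + 1) ((x - 1) P')'], [R_n = (x - 1) ((x + 1) P')'] and
   [S_n = L (x^2 - 1) P''].  Legendre's equation then turns the Krall polynomial
   into [y = A P + B P'] with [A] constant and [B] of degree 1 in [x].  At a
   point [x] with [x^2 <> 1], Legendre's equation and its derivatives express
   all [P^(k)(x)] through [P(x)] and [P'(x)], so the sixth-order equation becomes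
   an identity of rational functions; finally, two polynomials which agree off
   the points [1] and [-1] are equal. *)

Require Import Defs.
From mathcomp Require Import all_boot all_order all_algebra reals.
From mathcomp Require Import ring.

Set Implicit Arguments.
Unset Strict Implicit.
Unset Printing Implicit Defensive.

Import Order.TTheory GRing.Theory Num.Theory.

Local Open Scope ring_scope.

(** * Pochhammer symbols *)

Lemma poch0 (R : realType) (a : R) : poch a 0 = 1.
Proof. by rewrite /poch big_ord0. Qed.

Lemma pochS (R : realType) (a : R) k : poch a k.+1 = poch a k * (a + k%:R).
Proof. by rewrite /poch big_ord_recr. Qed.

Lemma pochSl (R : realType) (a : R) k : poch a k.+1 = a * poch (a + 1) k.
Proof.
rewrite /poch big_ord_recl addr0; congr (_ * _).
by apply: eq_bigr => i _; rewrite -addrA nat1r.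
Qed.

Lemma poch_neq0 (R : realType) (a : R) k : 0 < a -> poch a k != 0.
Proof. by move=> a0; rewrite gt_eqF// prodr_gt0// => i _; rewrite ltr_wpDr. Qed.

Lemma poch_oppn_eq0 (R : realType) n k : (n < k)%N -> poch (- n%:R : R) k = 0.
Proof. by move=> nk; rewrite /poch (bigD1 (Ordinal nk))//= addNr mul0r. Qed.

Lemma natr_fact_neq0 (R : realType) k : (k`!%:R : R) != 0.
Proof. by rewrite pnatr_eq0 -lt0n fact_gt0. Qed.

Lemma poch_nat (R : realType) m k :
  poch (m.+1%:R : R) k = (m + k)`!%:R / m`!%:R.
Proof.
elim: k => [|k IH]; first by rewrite poch0 addn0 divff ?natr_fact_neq0.
by rewrite pochS IH addnS factS -natrD addSn natrM mulrC mulrA.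
Qed.

(** * Terminating hypergeometric series, coefficient by coefficient *)

(** The series 2F1(-n, b; c; z) as a polynomial in its own variable z, so that identities can be
    read off coefficients before z = (1 - x) / 2 is substituted. *)
Definition gauss (R : realType) (n : nat) (b c : R) : {poly R} :=
  \poly_(k < n.+1) (poch (- n%:R) k * poch b k / (poch c k * k`!%:R)).

(** No bound on k is required, because (-n)_k = 0 for k > n. *)
Lemma coef_gauss (R : realType) n (b c : R) k :
  (gauss n b c)`_k = poch (- n%:R) k * poch b k / (poch c k * k`!%:R).
Proof.
rewrite coef_poly; case: ltnP => // nk.
by rewrite poch_oppn_eq0 // !mul0r.
Qed.

Lemma coef_gaussS (R : realType) n (b c : R) k : 0 < c ->
  (gauss n b c)`_k.+1 =
  (k%:R - n%:R) * (b + k%:R) / (k.+1%:R * (c + k%:R)) * (gauss n b c)`_k.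
Proof.
move=> c0; rewrite !coef_gauss !pochS factS natrM.
have pc0 := poch_neq0 k c0; have f0 := natr_fact_neq0 R k.
have ck0 : c + k%:R != 0 by rewrite gt_eqF // ltr_wpDr.
by field; rewrite f0 pc0 ck0 nat1r pnatr_eq0.
Qed.

Lemma coef_gauss_shift (R : realType) n (b c : R) k : 0 < c ->
  (c + k%:R) * (gauss n b (c + 1))`_k = c * (gauss n b c)`_k.
Proof.
move=> c0; rewrite !coef_gauss.
have E : poch c k * (c + k%:R) = c * poch (c + 1) k by rewrite -pochS pochSl.
have pc0 := poch_neq0 k c0; have f0 := natr_fact_neq0 R k.
have pc1 : poch (c + 1) k != 0 by rewrite poch_neq0 // addr_gt0.
have -> : c + k%:R = c * poch (c + 1) k / poch c k.
  by rewrite -E mulrAC divff ?mul1r.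
by field; rewrite f0 pc0 pc1.
Qed.

Lemma deriv_gauss (R : realType) n (b c : R) : 0 < c ->
  (gauss n.+1 b c)^`() = (- n.+1%:R * b / c) *: gauss n (b + 1) (c + 1).
Proof.
move=> c0; apply/polyP => k.
rewrite coef_deriv coefZ !coef_gauss -[LHS]mulr_natr.
have <- : - n.+1%:R + 1 = - n%:R :> R by rewrite -natr1 opprD addrNK.
rewrite !pochSl factS natrM.
have f0 := natr_fact_neq0 R k.
have pc1 : poch (c + 1) k != 0 by rewrite poch_neq0 // addr_gt0.
by field; rewrite f0 pc1 nat1r pnatr_eq0 gt_eqF.
Qed.

Lemma coefX_deriv (R : nzRingType) (p : {poly R}) k :
  ('X * p^`())`_k = k%:R * p`_k.
Proof.
by rewrite coefXM; case: k => [|k] /=; rewrite ?mul0r // coef_deriv mulr_natl.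
Qed.

Lemma gauss_legendre (R : realType) n (h := gauss n (n%:R + 1 : R) 1) :
  (('X^2 - 'X) * h^`())^`() = (n%:R * (n%:R + 1)) *: h.
Proof.
(* Multiplication by k on coefficients is the operator z d/dz; in this form both sides become
   multiples of the k-th coefficient of [h]. *)
have -> : ('X^2 - 'X) * h^`() = 'X * ('X * h^`()) - 'X * h^`() by ring.
apply/polyP => k; rewrite coef_deriv coefB coefXM !coefX_deriv /= coefZ.
rewrite -[LHS]mulr_natr coef_gaussS //.
by field; rewrite nat1r pnatr_eq0.
Qed.

Lemma deriv_X_gauss2 (R : realType) n (b : R) :
  ('X * gauss n b 2)^`() = gauss n b 1.
Proof.
apply/polyP => k; rewrite coef_deriv coefXM /= -[LHS]mulr_natr mulrC.
have := coef_gauss_shift n b k (ltr01 : 0 < 1 :> R); rewrite mul1r => <-.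
by rewrite nat1r.
Qed.

(** Both sides reduce to the k-th coefficient for c = 2: the left by the term ratio, the right by
    the shift from c = 2 to c = 3. As z - 1 = -(x + 1) / 2, this serves for R_n. *)
Lemma deriv_XB1_gauss2 (R : realType) n :
  (('X - 1) * gauss n (n%:R + 3 : R) 2)^`() =
  (n.+1%:R * n.+2%:R / 2) *: gauss n (n%:R + 3) 3.
Proof.
apply/polyP => k; rewrite mulrBl mul1r coef_deriv coefB coefXM coefZ /=.
rewrite coef_gaussS //.
have k2 : 2 + k%:R != 0 :> R by rewrite -natrD pnatr_eq0.
have -> : (gauss n (n%:R + 3 : R) 3)`_k =
    2 * (gauss n (n%:R + 3 : R) 2)`_k / (2 + k%:R).
  apply: (canRL (mulfK k2)); rewrite mulrC -coef_gauss_shift //.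
  by congr (_ * (gauss _ _ _)`_k); ring.
rewrite -[LHS]mulr_natr; field.
by rewrite k2 nat1r pnatr_eq0.
Qed.

(** * The substitution z = (1 - x) / 2 and Legendre's equation *)

Definition half1BX (R : realType) : {poly R} := 2^-1 *: (1 - 'X).

Lemma jacobi_gauss (R : realType) (a b : R) n :
  jacobi a b n = (poch (a + 1) n / n`!%:R) *:
    (gauss n (n%:R + a + b + 1) (a + 1) \Po half1BX R).
Proof.
rewrite /jacobi; congr (_ *: _); rewrite /gauss poly_def linear_sum /=.
by apply: eq_bigr => i _; rewrite linearZ /= rmorphXn /= comp_polyX.
Qed.

Lemma polyXE_half1BX (R : realType) : 'X = 1 - 2 *: half1BX R.
Proof. by rewrite scalerA divff ?pnatr_eq0 // scale1r opprB addrC subrK. Qed.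

Lemma deriv_half1BX (R : realType) : (half1BX R)^`() = - 2^-1%:P.
Proof.
by rewrite derivZ derivB derivX derivC sub0r scalerN -mul_polyC mulr1.
Qed.

Lemma deriv_mulZr (R : comNzRingType) (c : R) (p q : {poly R}) :
  (p * (c *: q))^`() = c *: (p * q)^`().
Proof. by rewrite -scalerAr derivZ. Qed.

Lemma deriv_comp_half1BX (R : realType) (p : {poly R}) :
  (p \Po half1BX R)^`() = (- 2^-1) *: (p^`() \Po half1BX R).
Proof. by rewrite deriv_comp deriv_half1BX mulrC -polyCN mul_polyC. Qed.

(** Each of the two differentiations contributes a chain-rule factor -1/2, whence 1/4. *)
Lemma deriv_mul_comp_half1BX (R : realType) (c : R) (p h : {poly R}) :
  ((c *: (p \Po half1BX R)) * (h \Po half1BX R)^`())^`() =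
  (c / 4) *: ((p * h^`())^`() \Po half1BX R).
Proof.
rewrite deriv_comp_half1BX -scalerAl -scalerAr -comp_polyM scalerA derivZ.
by rewrite deriv_comp_half1BX scalerA; congr (_ *: _); field.
Qed.

Lemma legendre_gauss (R : realType) n :
  jacobi 0 0 n = gauss n (n%:R + 1 : R) 1 \Po half1BX R.
Proof.
rewrite jacobi_gauss !addr0 add0r (poch_nat _ 0) fact0 divr1 divff ?scale1r //.
exact: natr_fact_neq0.
Qed.

Lemma legendre_ode (R : realType) n (P := jacobi 0 0 n : {poly R}) :
  (('X^2 - 1) * P^`())^`() = (n%:R * (n%:R + 1)) *: P.
Proof.
have wE : 'X^2 - 1 = 4 *: (('X^2 - 'X) \Po half1BX R).
  rewrite rmorphB /= rmorphXn /= comp_polyX [X in X ^+ 2 - _]polyXE_half1BX.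
  by rewrite -!mul_polyC !polyC_natr; ring.
rewrite /P legendre_gauss wE deriv_mul_comp_half1BX gauss_legendre linearZ.
by rewrite divff ?pnatr_eq0 // scale1r.
Qed.

(** * Q_n, R_n and S_n in terms of the Legendre polynomial *)

Lemma deriv_legendre (R : realType) n (h := gauss n.+1 (n.+1%:R + 1 : R) 1) :
  h^`() = (- (n.+1%:R * n.+2%:R)) *: gauss n (n%:R + 3) 2.
Proof.
rewrite deriv_gauss //.
by congr (_ *: gauss _ _ _); rewrite -!natr1; [field | ring].
Qed.

Lemma koornwinderQ_legendre (R : realType) n (P := jacobi 0 0 n : {poly R}) :
  koornwinderQ 0 0 n = ('X + 1) * (('X - 1) * P^`())^`().
Proof.
rewrite /P legendre_gauss; case: n {P} => [|n].
  (* For n = 0 the Legendre polynomial is constant and both sides vanish. *)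
  rewrite /gauss poly_def big_ord1 expr0 alg_polyC comp_polyC derivC mulr0.
  by rewrite -[X in X^`()]/(0%:P) derivC mulr0.
have -> : 'X - 1 = (-2) *: ('X \Po half1BX R).
  by rewrite comp_polyX [X in X - _]polyXE_half1BX addrAC subrr sub0r scaleNr.
rewrite deriv_mul_comp_half1BX deriv_legendre deriv_mulZr deriv_X_gauss2.
rewrite /koornwinderQ jacobi_gauss linearZ /= -!scalerAr !scalerA !add0r addr0.
(* At positive integers the Pochhammer symbols are quotients of factorials, so the two constants can
   be compared by [field]. *)
rewrite !(poch_nat _ 0) !(poch_nat _ 1) !add0n !add1n !factS fact0 muln1 !natrM.
congr (_ *: (_ * (gauss _ _ _ \Po _))); last by ring.
by field; rewrite natr_fact_neq0 nat1r pnatr_eq0.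
Qed.

Lemma koornwinderR_legendre (R : realType) n (P := jacobi 0 0 n : {poly R}) :
  koornwinderR 0 0 n = ('X - 1) * (('X + 1) * P^`())^`().
Proof.
rewrite /P legendre_gauss; case: n {P} => [|n].
  rewrite /gauss poly_def big_ord1 expr0 alg_polyC comp_polyC derivC mulr0.
  by rewrite -[X in X^`()]/(0%:P) derivC mulr0.
have -> : 'X + 1 = (-2) *: (('X - 1) \Po half1BX R).
  rewrite rmorphB rmorph1 /= comp_polyX [X in X + _]polyXE_half1BX.
  by rewrite -!mul_polyC polyCN polyC_natr; ring.
rewrite deriv_mul_comp_half1BX deriv_legendre deriv_mulZr deriv_XB1_gauss2.
rewrite /koornwinderR jacobi_gauss !linearZ /= -!scalerAr !scalerA !add0r addr0.
rewrite (natr1 2) !(poch_nat _ 2) !(poch_nat _ 0) !(poch_nat _ 1).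
rewrite !add0n !add1n ?add2n !factS fact0 muln1 !natrM.
congr (_ *: (_ * (gauss _ _ _ \Po _))); last by ring.
by field; rewrite natr_fact_neq0 nat1r pnatr_eq0.
Qed.

Lemma koornwinderS_legendre (R : realType) n (P := jacobi 0 0 n : {poly R}) :
  koornwinderS 0 0 n = (n%:R * (n%:R + 1)) *: (('X^2 - 1) * P^`(2)).
Proof.
rewrite /P legendre_gauss; case: n {P} => [|n].
  by rewrite mul0r scale0r.
rewrite derivSn derivn1 deriv_comp_half1BX derivZ deriv_comp_half1BX.
rewrite deriv_legendre.
(* In degree 1 the second derivative vanishes, in accordance with S_1 = 0. *)
case: n => [|n].
  rewrite [gauss 0 _ _]/gauss poly_def big_ord1 expr0 alg_polyC derivZ derivC.
  by rewrite !(scaler0, comp_poly0, mulr0).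
rewrite derivZ deriv_gauss // !linearZ /= /koornwinderS jacobi_gauss.
rewrite -!scalerAr !scalerA !add0r (natr1 2) !(poch_nat _ 2) !(poch_nat _ 1).
rewrite !add1n !add2n !factS fact0 muln1 !natrM.
congr (_ *: (_ * (gauss _ _ _ \Po _))); rewrite -?natr1; last by ring.
by field; rewrite natr_fact_neq0 !natr1 !pnatr_eq0.
Qed.

(** * Leibniz rules for linear and quadratic factors; equality off finitely many points *)

Lemma derivM_deriv1 (R : comNzRingType) (q p : {poly R}) : q^`() = 1 ->
  (q * p)^`() = q * p^`() + p.
Proof. by move=> q1; rewrite derivM q1 mul1r addrC. Qed.

(** Leibniz's rule stops after two terms; at n = 0 the truncated [n.-1] comes with coefficient 0. *)
Lemma derivnM_deriv1 (R : comNzRingType) (q p : {poly R}) n : q^`() = 1 ->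
  (q * p)^`(n) = q * p^`(n) + n%:R * p^`(n.-1).
Proof.
move=> q1; elim: n => [|n IH]; first by rewrite mul0r addr0.
rewrite derivnS IH derivD derivM_deriv1 // -derivnS mulr_natl derivMn.
case: n {IH} => [|n]; first by rewrite mulr0n addr0 mul1r.
by rewrite -derivnS -mulr_natl -natr1; ring.
Qed.

Lemma deriv2M_sqr_deriv1 (R : comNzRingType) (q p : {poly R}) : q^`() = 1 ->
  (q ^+ 2 * p)^`(2) = q ^+ 2 * p^`(2) + 4 * q * p^`(1) + 2 * p.
Proof. by move=> q1; rewrite expr2 -!mulrA !derivnM_deriv1 //=; ring. Qed.

Lemma deriv_XD1 (R : nzRingType) : ('X + 1 : {poly R})^`() = 1.
Proof. by rewrite derivD derivX derivC addr0. Qed.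

Lemma deriv_XB1 (R : nzRingType) : ('X - 1 : {poly R})^`() = 1.
Proof. by rewrite derivB derivX derivC subr0. Qed.

Lemma derivn_add (R : nzRingType) (p : {poly R}) m n :
  (p^`(m))^`(n) = p^`(n + m).
Proof. by rewrite /derivn iterD. Qed.

(** After multiplication by [w] the two sides agree at every point. Their difference [r] then has
    the [size r] distinct roots 0, 1, 2, ..., more than its degree allows, and [w] cancels. *)
Lemma poly_eq_off_roots (R : numDomainType) (w p q : {poly R}) : w != 0 ->
  (forall x, w.[x] != 0 -> p.[x] = q.[x]) -> p = q.
Proof.
move=> w0 pq; apply: (mulfI w0); apply/eqP; rewrite -subr_eq0; apply/eqP.
set r := w * p - w * q.
apply: (@roots_geq_poly_eq0 _ r [seq k%:R | k <- iota 0 (size r)]).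
- apply/allP => x _; rewrite /root /r !hornerE.
  by have [->|/pq ->] := eqVneq w.[x] 0; rewrite ?mul0r subrr.
- by rewrite map_inj_uniq ?iota_uniq //; apply: mulrIn; rewrite oner_eq0.
- by rewrite size_map size_iota.
Qed.

Lemma derivnM_X2B1 (R : comNzRingType) (p : {poly R}) n :
  (('X^2 - 1) * p)^`(n) =
  ('X^2 - 1) * p^`(n) + (2 * n%:R) * 'X * p^`(n.-1)
  + (n%:R * n.-1%:R) * p^`(n.-2).
Proof.
have -> : 'X^2 - 1 = ('X + 1) * ('X - 1) :> {poly R} by ring.
rewrite -!mulrA !derivnM_deriv1 ?deriv_XD1 ?deriv_XB1 //.
by case: n => [|[|n]] /=; ring.
Qed.

(** * Higher derivatives of the Legendre and Krall polynomials *)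

(** Legendre's equation differentiated k times. *)
Lemma legendre_odeS (R : realType) n k (P := jacobi 0 0 n : {poly R}) :
  ('X^2 - 1) * P^`(k.+2) =
  (n%:R * (n%:R + 1) - k%:R * k.+1%:R) * P^`(k)
  - 2 * k.+1%:R * 'X * P^`(k.+1).
Proof.
have := legendre_ode R n; rewrite -/P; move: P => P /(congr1 (derivn k)).
rewrite -derivSn derivnM_X2B1 -!derivSn derivnZ -mul_polyC /=.
rewrite !(polyCD, polyCM, polyC_natr, polyC1) => E; rewrite [in RHS]mulrBl -E.
by case: k {E} => [|k] /=; ring.
Qed.

Lemma krall_legendre (R : realType) (M N : R) n (P := jacobi 0 0 n : {poly R})
    (L := n%:R * (n%:R + 1)) :
  krall M N n = (1 + (M + N) * L + M * N * L ^+ 2) *: P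
   + ((- (M + N + 2 * M * N * L)) *: 'X + (M - N)%:P) * P^`().
Proof.
(* Q_n, R_n and S_n involve P'' only through (x^2 - 1) P'', which this identity eliminates. *)
have E : ('X^2 - 1) * P^`()^`() = L%:P * P - 2 * 'X * P^`().
  rewrite (legendre_odeS R n 0) /L.
  by rewrite !(polyCD, polyCM, polyC_natr, polyC1); ring.
rewrite /krall /koornwinder koornwinderQ_legendre koornwinderR_legendre.
rewrite koornwinderS_legendre -/P -/L /=; move: P E => P E.
have QE : ('X + 1) * (('X - 1) * P^`())^`() = L%:P * P - ('X - 1) * P^`().
  transitivity (('X + 1) * P^`() + ('X^2 - 1) * P^`()^`());
    last by rewrite E; ring.
  by rewrite derivM_deriv1 ?deriv_XB1 //; ring.
have RE : ('X - 1) * (('X + 1) * P^`())^`() = L%:P * P - ('X + 1) * P^`().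
  transitivity (('X - 1) * P^`() + ('X^2 - 1) * P^`()^`());
    last by rewrite E; ring.
  by rewrite derivM_deriv1 ?deriv_XD1 //; ring.
rewrite QE RE E -!mul_polyC.
by rewrite !(polyCN, polyCD, polyCM, polyC_exp, polyC_natr, polyC1); ring.
Qed.

(* [P k] and [y k] are the values at [x] of the [k]-th derivatives of [P] and [y],
   and [u k], [v k], [w k] those of the [k]-th derivatives of [(x + 1) y],
   [(x - 1) y] and [(x^2 - 1) y]; the truncated [k.-1] and [k.-2] are harmless,
   as their coefficients then vanish. *)
Lemma krall_ode_coords (F : numFieldType) (x L M N : F) (P y : nat -> F)
    (A := 1 + (M + N) * L + M * N * L ^+ 2)
    (B1 := - (M + N + 2 * M * N * L)) (B := B1 * x + (M - N))
    (u := fun k => (x + 1) * y k + k%:R * y k.-1)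
    (v := fun k => (x - 1) * y k + k%:R * y k.-1)
    (w := fun k => (x ^+ 2 - 1) * y k + 2 * k%:R * x * y k.-1
                   + k%:R * k.-1%:R * y k.-2) :
  x ^+ 2 - 1 != 0 ->
  (forall k, (x ^+ 2 - 1) * P k.+2 =
    (L - k%:R * k.+1%:R) * P k - 2 * k.+1%:R * x * P k.+1) ->
  (forall k, y k = A * P k + B * P k.+1 + k%:R * B1 * P k) ->
  ((x ^+ 2 - 1) * y 2%N + 2 * x * y 1%N)
  + M / 2 * ((x + 1) * ((x - 1) ^+ 2 * u 4%N + 4 * (x - 1) * u 3%N + 2 * u 2%N))
  + N / 2 * ((x - 1) * ((x + 1) ^+ 2 * v 4%N + 4 * (x + 1) * v 3%N + 2 * v 2%N))
  + M * N / 3 *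
      ((x ^+ 2 - 1) * ((x ^+ 2 - 1) * w 6%N + 6 * x * w 5%N + 6 * w 4%N))
  = L * (1 + (M + N) / 2 * L + M * N / 3 * (L * (L - 2))) * y 0%N.
Proof.
move=> w0 HP Hy; rewrite /u /v /w !Hy /B /A /B1 /=.
(* Used as a rewriting rule, this reduces [P 2] up to [P 7] to [P 0] and [P 1]. *)
have {}HP k : P k.+2 =
    ((L - k%:R * k.+1%:R) * P k - 2 * k.+1%:R * x * P k.+1) / (x ^+ 2 - 1).
  by apply: (mulfI w0); rewrite HP mulrCA divff ?mulr1.
by rewrite !HP; field.
Qed.

(** Since the factor of P' has constant slope [B1], Leibniz's rule adds only the term k [B1]
    P^(k). *)
Lemma derivn_krall (R : realType) (M N : R) n k (P := jacobi 0 0 n : {poly R})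
    (L := n%:R * (n%:R + 1)) (B1 := - (M + N + 2 * M * N * L)) :
  (krall M N n)^`(k) =
  (1 + (M + N) * L + M * N * L ^+ 2) *: P^`(k)
  + (B1 *: 'X + (M - N)%:P) * P^`(k.+1) + (k%:R * B1) *: P^`(k).
Proof.
rewrite krall_legendre -/P -/L -/B1; move: P => P.
rewrite (mulrDl (B1 *: 'X)) -scalerAl mul_polyC !derivnD !derivnZ.
rewrite derivnM_deriv1 ?derivX // -!derivSn -!mul_polyC.
rewrite [(k%:R * B1)%:P]polyCM polyC_natr.
by case: k => [|k]; rewrite -?derivSn; ring.
Qed.

Theorem corollary2p4 (R : realType) (M N : R) (hM : 0 < M) (hN : 0 < N)
    (n : nat) :
  let y := krall M N n in
  (('X^2 - 1) * y^`())^`()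
  + (M / 2) *: (('X + 1) * (('X - 1) ^+ 2 * (('X + 1) * y)^`(2))^`(2))
  + (N / 2) *: (('X - 1) * (('X + 1) ^+ 2 * (('X - 1) * y)^`(2))^`(2))
  + (M * N / 3) *:
      (('X^2 - 1) * (('X^2 - 1) * (('X^2 - 1) * y)^`(3))^`(3))
  = (poch n%:R 2 * (1 + (M + N) / 2 * poch n%:R 2
                      + M * N / 3 * poch (n%:R - 1) 4)) *: y.
Proof.
move=> y.
have w0 : 'X^2 - 1 != 0 :> {poly R} by rewrite -size_poly_eq0 size_XnsubC.
pose L : R := n%:R * (n%:R + 1).
have LE : poch n%:R 2 = L by rewrite !pochS poch0 mul1r addr0.
(* Here (n - 1)(n + 2) = L - 2, so the eigenvalue depends on n only through [L]. *)
have LLE : poch (n%:R - 1) 4 = L * (L - 2) :> R.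
  by rewrite !pochS poch0 /L; ring.
have PP := legendre_odeS R n; have := derivn_krall M N n; rewrite -/y => Py.
(* From here on [P] and [y] are arbitrary polynomials, known only through the recurrence [PP] and
   the formula [Py]. *)
rewrite {}LE {}LLE; move: y (jacobi 0 0 n) PP Py => y P PP Py.
rewrite -[(_ * y^`())^`()]derivn1 (derivnM_X2B1 y^`()) -[y^`()]derivn1.
(* The outer derivatives are expanded first; the inner ones then merge into derivatives of (x + 1)
   y, (x - 1) y and (x^2 - 1) y, of order at most 6. *)
rewrite !deriv2M_sqr_deriv1 ?deriv_XD1 ?deriv_XB1 // (derivnM_X2B1 (_^`(3))).
rewrite !derivn_add !derivnM_X2B1 !derivnM_deriv1 ?deriv_XD1 ?deriv_XB1 //.
apply: (poly_eq_off_roots w0) => x.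
have hnat k : (k%:R : {poly R}).[x] = k%:R by rewrite -polyC_natr hornerC.
pose hE := (hornerD, hornerN, hornerM, hornerZ, hornerX, hornerC, hornerXn,
            horner_exp, hnat, hnat 1).
rewrite !hE => x1.
apply: etrans (etrans _ (@krall_ode_coords R x L M N
  (fun k => P^`(k).[x]) (fun k => y^`(k).[x]) x1 _ _)) _.
- by rewrite /addn /=; ring.
- by move=> k; move: (congr1 (horner^~ x) (PP k)); rewrite /= !hE.
- by move=> k; rewrite Py !hE.
- by [].
Qed.
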